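(* Let $0\le t\le N-2$ and let $\mathcal{R}\subseteq\mathcal{X}_{t+1}$ be a polytope on which the certainty equivalence controller is optimal at time $t+1$ (in the sense defined in the context). Let $\mathcal{R}=\{x\in\mathbb{R}^n : R^x x\le R^c\}$ and $\mathcal{X}_{t+1}=\{x\in\mathbb{R}^n : P^x x\le P^c\}$ be normalized minimal representations, with $p$ and $q$ rows respectively, and let $E\subseteq\{1,\dots,p\}$ be the set of indices of constraints exclusive to $\mathcal{R}$, i.e. of those rows $i$ for which the inequality $R^x_i x\le R^c_i$ is not one of the inequalities $P^x_j x\le P^c_j$, $j\in\{1,\dots,q\}$. Consider the restricted problem $$\inf_{u\in\mathcal{U}} J_t(x,u)\quad\text{subject to } Ax+Bu+d\in\mathcal{R}\ \ \forall d\in\mathcal{D}_t \qquad (\mathrm{P}_{\mathcal{R}})$$ and the exact problem $$\inf_{u\in\mathcal{U}} J_t(x,u)\quad\text{subject to } Ax+Bu+d\in\mathcal{X}_{t+1}\ \ \forall d\in\mathcal{D}_t. \qquad (\mathrm{P})$$ Let $\mathcal{C}$ be a critical region of the restricted problem (as defined in the context) for which all the constraints indexed by $E$ are inactive, i.e. for every $x\in\mathcal{C}$ the optimizer $u^*(x)$ of the restricted problem satisfies $R^x_i(Ax+Bu^*(x))+\max_{d\in\mathcal{D}_t}R^x_i d<R^c_i$ for all $i\in E$. Then for every $x\in\mathcal{C}$ the problems $(\mathrm{P}_{\mathcal{R}})$ and $(\mathrm{P})$ have the same optimizers.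
   Context: System: $x_{t+1}=Ax_t+Bu_t+d_t$, with $x_t,d_t\in\mathbb{R}^n$, $u_t\in\mathbb{R}^p$, $A\in\mathbb{R}^{n\times n}$, $B\in\mathbb{R}^{n\times p}$ (the input dimension is unrelated to the number of rows, also called $p$, in the claim). State constraints $x_t\in\mathcal{X}_t$ and input constraints $u_t\in\mathcal{U}$, where $\mathcal{X}_t\subset\mathbb{R}^n$ and $\mathcal{U}\subset\mathbb{R}^p$ are polytopes (bounded). The disturbances $d_0,d_1,\dots$ are independent random vectors, $d_t$ taking values in a polytope $\mathcal{D}_t\subset\mathbb{R}^n$; they need not have zero mean. The horizon $N$ is fixed, and the costs are $f_N(x,u)=f_N(x)=x^TQ_Nx$ and $f_t(x,u)=x^TQ_tx+u^TR_tu$ for $0\le t\le N-1$, with all $Q_t\succ0$, $R_t\succ0$. Exact dynamic program: $J_N^*(x)=f_N(x)$, and for $t=N-1,\dots,0$ and $x\in\mathcal{X}_t$, $$J_t(x,u)=f_t(x,u)+E_{d_t}\big(J^*_{t+1}(Ax+Bu+d_t)\big),$$ $$J_t^*(x)=\inf_{u\in\mathcal{U}}J_t(x,u)\ \text{ subject to } Ax+Bu+d\in\mathcal{X}_{t+1}\ \forall d\in\mathcal{D}_t,$$ with optimizer denoted $\pi_t^*(x)$. Certainty equivalence dynamic program: $\tilde J_N^*(x)=f_N(x)$, and for $t=N-1,\dots,0$ and $x\in\mathcal{X}_t$, $$\tilde J_t(x,u)=f_t(x,u)+\tilde J^*_{t+1}(Ax+Bu+E(d_t)),$$ $$\tilde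 J_t^*(x)=\inf_{u\in\mathcal{U}}\tilde J_t(x,u)\ \text{ subject to } Ax+Bu+d\in\mathcal{X}_{t+1}\ \forall d\in\mathcal{D}_t,$$ with optimizer denoted $\tilde\pi_t^*(x)$. Convention: the infimum of an infeasible problem is $+\infty$. The certainty equivalence controller is optimal on $\mathcal{R}\subseteq\mathcal{X}_{t+1}$ at time $t+1$ if, on $\mathcal{R}$, both dynamic programs are feasible at time $t+1$, $\pi^*_{t+1}(x)=\tilde\pi^*_{t+1}(x)$ for all $x\in\mathcal{R}$, $\tilde J^*_{t+1}-J^*_{t+1}$ is constant on $\mathcal{R}$, and (as is the case for the critical regions considered) $J^*_{t+1}$ coincides on $\mathcal{R}$ with a quadratic function. Under these conditions the restricted problem $(\mathrm{P}_{\mathcal{R}})$ has the same optimizer as its certainty equivalence version $\inf_{u\in\mathcal{U}}\tilde J_t(x,u)$ subject to $Ax+Bu+d\in\mathcal{R}\ \forall d\in\mathcal{D}_t$, which is a multiparametric quadratic program in the parameter $x\in\mathcal{X}_t$. The robust constraint is the system of inequalities $R^x_i(Ax+Bu)+\max_{d\in\mathcal{D}_t}R^x_id\le R^c_i$, $i=1,\dots,p$; constraint $i$ is active at $(x,u)$ if this holds with equality and inactive if the inequality is strict. A critical region of the restricted problem is a set of all parameters $x$ for which the problem is feasible and one and the same set of constraints is active at the optimizer. A representation is normalized if every row of the constraint matrix has unit norm; $R^x_i$ denotes the $i$-th row of $R^x$. *)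

(* Defs.v *)
From HB Require Import structures.
From mathcomp Require Import all_boot all_order all_algebra.
From mathcomp Require Import finmap.
From mathcomp Require Import all_classical all_reals all_analysis.
Set Implicit Arguments.
Unset Strict Implicit.
Unset Printing Implicit Defensive.
Import Order.TTheory GRing.Theory Num.Theory.
Import numFieldNormedType.Exports.
Local Open Scope classical_set_scope.
Local Open Scope ring_scope.

Definition qform (R : realType) (k : nat) (M : 'M[R]_k) (x : 'cV[R]_k) : R :=
  (x^T *m M *m x) ord0 ord0.

Definition posdefmx (R : realType) (k : nat) (M : 'M[R]_k) : Prop :=
  M^T = M /\ forall x : 'cV[R]_k, x != 0 -> 0 < qform M x.

Definition polyhedron (R : realType) (k r : nat)
    (H : 'M[R]_(r, k)) (h : 'cV[R]_r) : set 'cV[R]_k :=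
  [set x | forall i, (H *m x) i ord0 <= h i ord0].

Definition polytope (R : realType) (k : nat) (S : set 'cV[R]_k) : Prop :=
  bounded_set S /\
  exists (r : nat) (H : 'M[R]_(r, k)) (h : 'cV[R]_r), S = polyhedron H h.

(* The library norm on matrices is the sup norm, hence the explicit
   Euclidean norm of the rows. *)
Definition normalized (R : realType) (k r : nat) (H : 'M[R]_(r, k)) : Prop :=
  forall i, Num.sqrt (\sum_(j < k) H i j ^+ 2) = 1.

(* Minimality in the sense of irredundancy: dropping any single row changes
   the set that is represented. *)
Definition minimal_repr (R : realType) (k r : nat)
    (H : 'M[R]_(r, k)) (h : 'cV[R]_r) : Prop :=
  forall i, [set x : 'cV[R]_k |
    forall j, j != i -> (H *m x) j ord0 <= h j ord0] <> polyhedron H h.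

Definition borelV (R : realType) (k : nat) :=
  g_sigma_algebraType (@open 'cV[R]_k).

Definition mutually_independent (R : realType) (dO : measure_display)
    (Omega : measurableType dO) (P : probability Omega R) (k : nat)
    (X : nat -> Omega -> 'cV[R]_k) : Prop :=
  forall (F : {fset nat}) (C : nat -> set (borelV R k)),
    (forall t, measurable (C t)) ->
    P (\bigcap_(t in [set` F]) (X t @^-1` C t)) =
    (\prod_(t <- F) P (X t @^-1` C t))%E.

Record ocp (R : realType) (dO : measure_display) (Omega : measurableType dO)
    (n m : nat) := OCP {
  horizon : nat;
  dynA : 'M[R]_n;
  dynB : 'M[R]_(n, m);
  stateC : nat -> set 'cV[R]_n;
  inputC : set 'cV[R]_m;
  prob : probability Omega R;
  dist : nat -> Omega -> 'cV[R]_n;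
  distC : nat -> set 'cV[R]_n;
  stateW : nat -> 'M[R]_n;
  inputW : nat -> 'M[R]_m }.

Record standing_assumptions (R : realType) (dO : measure_display)
    (Omega : measurableType dO) (n m : nat) (S : ocp R Omega n m) : Prop := {
  stateC_polytope : forall t, (t <= horizon S)%N -> polytope (stateC S t);
  inputC_polytope : polytope (inputC S);
  distC_polytope : forall t, polytope (distC S t);
  dist_measurable : forall t,
    measurable_fun setT (dist S t : Omega -> borelV R n);
  dist_in : forall t w, distC S t (dist S t w);
  dist_indep : mutually_independent (prob S) (dist S);
  stateW_posdef : forall t, (t <= horizon S)%N -> posdefmx (stateW S t);
  inputW_posdef : forall t, (t < horizon S)%N -> posdefmx (inputW S t) }.

Section DynamicProgram.
Context (R : realType) (dO : measure_display) (Omega : measurableType dO).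
Context (n m : nat) (S : ocp R Omega n m).
Implicit Types (t k : nat) (x y : 'cV[R]_n) (u : 'cV[R]_m).

Definition nominal x u : 'cV[R]_n := dynA S *m x + dynB S *m u.

Definition stage_cost t x u : R :=
  qform (stateW S t) x + qform (inputW S t) u.

Definition robust_inputs t (T : set 'cV[R]_n) x : set 'cV[R]_m :=
  [set u | inputC S u /\ forall d, distC S t d -> T (nominal x u + d)].

Definition dist_mean t : 'cV[R]_n :=
  \col_i fine ('E_(prob S)[fun w => dist S t w i ord0])%E.

(* An "anticipation" sends a cost-to-go V at time t+1 and the disturbance-free
   successor y = Ax + Bu to the value that V contributes at time t; it is the
   only point where the exact and certainty equivalence programs differ. *)
Definition anticipation := nat -> ('cV[R]_n -> \bar R) -> 'cV[R]_n -> \bar R.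

Definition exact_ant : anticipation := fun t V y =>
  (\int[prob S]_w V (y + dist S t w)%R)%E.

Definition ce_ant : anticipation := fun t V y => V (y + dist_mean t).

(* The optimal cost with k steps to go, i.e. at time N - k. Outside of
   stateC S (N - k) the recursion gives values that are never used: only
   successors satisfying the robust state constraint are ever compared.
   ereal_inf set0 = +oo, so infeasible problems have cost +oo. *)
Fixpoint cost_to_go (a : anticipation) k x : \bar R :=
  if k is k'.+1 then
    let t := (horizon S - k)%N in
    ereal_inf [set ((stage_cost t x u)%:E
                    + a t (cost_to_go a k') (nominal x u))%E
              | u in robust_inputs t (stateC S t.+1) x]
  else (qform (stateW S (horizon S)) x)%:E.

Definition opt_cost a t x : \bar R := cost_to_go a (horizon S - t) x.

Definition cost a t x u : \bar R :=
  ((stage_cost t x u)%:E + a t (opt_cost a t.+1) (nominal x u))%E.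

Lemma opt_costN a x :
  opt_cost a (horizon S) x = (qform (stateW S (horizon S)) x)%:E.
Proof. by rewrite /opt_cost subnn. Qed.

Lemma opt_costE a t x : (t < horizon S)%N ->
  opt_cost a t x =
  ereal_inf [set cost a t x u | u in robust_inputs t (stateC S t.+1) x].
Proof.
move=> tN; rewrite /cost /opt_cost -{1}(subnSK tN) [LHS]/=.
by rewrite (subnSK tN) (subKn (ltnW tN)).
Qed.

End DynamicProgram.

Definition argmin (R : realType) (V : Type) (f : V -> \bar R) (C : set V) :
    set V :=
  [set u | C u /\ forall v, C v -> (f u <= f v)%E].

Section Policies.
Context (R : realType) (dO : measure_display) (Omega : measurableType dO).
Context (n m : nat) (S : ocp R Omega n m).
Implicit Types (t : nat) (x : 'cV[R]_n) (u : 'cV[R]_m).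

Definition J := cost S (exact_ant S).
Definition Jstar := opt_cost S (exact_ant S).
Definition Jce := cost S (ce_ant S).
Definition Jcestar := opt_cost S (ce_ant S).

Definition policy t x := argmin (J t x) (robust_inputs S t (stateC S t.+1) x).
Definition ce_policy t x :=
  argmin (Jce t x) (robust_inputs S t (stateC S t.+1) x).

(* Both programs have the same feasible inputs, so a single feasibility clause
   covers them. In \bar R a difference equal to c%:E forces both costs to be
   finite. *)
Definition ce_optimal_on t (T : set 'cV[R]_n) : Prop :=
  [/\ forall x, T x -> robust_inputs S t (stateC S t.+1) x !=set0,
      forall x, T x -> policy t x = ce_policy t x,
      exists c : R, forall x, T x -> (Jcestar t x - Jstar t x)%E = c%:E
    & exists (M : 'M[R]_n) (g : 'cV[R]_n) (c : R), forall x, T x ->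
        Jstar t x = (qform M x + (g^T *m x) ord0 ord0 + c)%:E].

Definition restricted_optimizers t (T : set 'cV[R]_n) x :=
  argmin (J t x) (robust_inputs S t T x).

(* distC S t is a nonempty polytope, so this sup is a max. *)
Definition max_dist t (r : nat) (H : 'M[R]_(r, n)) (i : 'I_r) : R :=
  sup [set (H *m d) i ord0 | d in distC S t].

Definition robust_lhs t (r : nat) (H : 'M[R]_(r, n)) x u (i : 'I_r) : R :=
  (H *m nominal S x u) i ord0 + max_dist t H i.

(* Critical region of the problem restricted to the target polyhedron H z <= h,
   with input constraints G u <= g: I is the set of active robust constraints
   and K the set of active input constraints. *)
Definition critical_region t (r : nat) (H : 'M[R]_(r, n)) (h : 'cV[R]_r)
    (s : nat) (G : 'M[R]_(s, m)) (g : 'cV[R]_s)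
    (I : set 'I_r) (K : set 'I_s) : set 'cV[R]_n :=
  [set x | stateC S t x /\
    exists2 u, restricted_optimizers t (polyhedron H h) x u &
      [set i | robust_lhs t H x u i = h i ord0] = I /\
      [set k | (G *m u) k ord0 = g k ord0] = K].

End Policies.

(* Inequalities are compared as (row, right-hand side) pairs. *)
Definition exclusive_rows (R : realType) (n p q : nat)
    (Rx : 'M[R]_(p, n)) (Rc : 'cV[R]_p) (Px : 'M[R]_(q, n)) (Pc : 'cV[R]_q) :
    set 'I_p :=
  [set i | ~ exists j, row i Rx = row j Px /\ Rc i ord0 = Pc j ord0].

(* Main.v *)
Require Import Defs.
From HB Require Import structures.
From mathcomp Require Import all_boot all_order all_algebra.
From mathcomp Require Import finmap.
From mathcomp Require Import all_classical all_reals all_analysis.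
From mathcomp Require Import measurable_realfun ring lra.
Set Implicit Arguments.
Unset Strict Implicit.
Unset Printing Implicit Defensive.
Import Order.TTheory GRing.Theory Num.Theory.
Import numFieldNormedType.Exports.
Local Open Scope classical_set_scope.
Local Open Scope ring_scope.

(** The exact problem and the restricted problem minimize the same cost
    J_t(x, .); only the feasible sets differ, and the restricted one is the
    smaller. The cost J_t(x, .) is strictly convex, and at an optimizer u of
    the restricted problem it is finite, because J*_{t+1} is quadratic, hence
    bounded, on the compact set that contains all successors of (x, u). If v is
    any other input feasible for the exact problem, then a short step from u
    towards v stays feasible for the restricted problem: the rows shared with
    the larger polytope hold along the whole segment by convexity
    ([convex_robust_inputs]), and the exclusive rows are slack at u, so they
    survive a small perturbation ([robust_inputs_short_step]). Optimality of u
    on that step and strict convexity give J_t(x, u) < J_t(x, v)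
    ([restricted_optimizer_lt]). So u is the only optimizer of either problem.

    The substance is the convexity of J_t, that is, of the costs-to-go. The
    recursion defines them on the whole space with values in [0, +oo], and
    there they are convex and lower semicontinuous
    ([closed_convex_cost_to_go]). Convexity alone would not propagate through
    the expectation: the integral is additive on measurable functions only.
    Lower semicontinuity supplies the measurability, and it is preserved by
    both operations of the recursion: by the expectation through the lemma of
    Fatou ([lsc_mean_cost]) and by the infimum over the compact set of inputs
    through a tube argument ([lsc_partial_inf]). *)

(** * Continuity and compactness for column vectors *)

Lemma cvg_mx (R : realType) (T : Type) (F : set_system T) (FF : Filter F)
    (k l : nat) (f : T -> 'M[R]_(k, l)) (M : 'M[R]_(k, l)) :
  (forall i j, f x i j @[x --> F] --> M i j) -> f x @[x --> F] --> M.
Proof.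
move=> fM; apply/cvg_ballP => e e0.
have : \forall x \near F, forall i j, ball (M i j) e (f x i j).
  apply: filter_forall => i; apply: filter_forall => j.
  by move: (fM i j) => /cvg_ballP; apply.
by apply: filterS => x Mx; split.
Qed.

Lemma mulmx_continuous (R : realType) (k l r : nat) (H : 'M[R]_(k, l)) :
  continuous (mulmx H : 'M[R]_(l, r) -> 'M[R]_(k, r)).
Proof.
move=> x; apply: (@cvg_mx _ _ _ (nbhs_filter x)) => i j.
under eq_cvg do rewrite mxE.
rewrite mxE.
apply: (@continuous_big _ _ _ _ _ (@add_continuous R)) => a _ z.
exact: cvgMr (@coord_continuous R l r a j z).
Qed.

Lemma trmx_continuous (R : realType) (k l : nat) :
  continuous (fun A : 'M[R]_(k, l) => A^T).
Proof.
move=> x; apply: (@cvg_mx _ _ _ (nbhs_filter x)) => i j.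
under eq_cvg do rewrite mxE.
by rewrite mxE; exact: coord_continuous.
Qed.

Lemma mulmx_coord_continuous (R : realType) (k r : nat) (H : 'M[R]_(r, k)) i j :
  continuous (fun x : 'cV[R]_k => (H *m x) i j).
Proof.
move=> x; apply: (@cvg_comp _ _ _ (mulmx H) (fun y : 'cV_r => y i j)).
  exact: mulmx_continuous.
exact: coord_continuous.
Qed.

Lemma qform_continuous (R : realType) (k : nat) (M : 'M[R]_k) :
  continuous (qform M).
Proof.
have -> : qform M = fun x => \sum_a x a ord0 * (M *m x) a ord0.
  by apply/funext => x; rewrite /qform -mulmxA mxE; under eq_bigr do rewrite mxE.
move=> x.
apply: (@continuous_big _ _ _ _ _ (@add_continuous R)) => a _ z.
apply: cvgM; [exact: (nbhs_filter z)|exact: (@coord_continuous R k 1 a ord0 z)|].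
exact: mulmx_coord_continuous.
Qed.

Lemma closed_polyhedron (R : realType) (k r : nat)
    (H : 'M[R]_(r, k)) (h : 'cV[R]_r) : closed (polyhedron H h).
Proof.
rewrite (_ : polyhedron H h = \bigcap_i [set x | (H *m x) i ord0 <= h i ord0]).
  apply: closed_bigI => i _.
  apply: (@preimage_closed _ _ (fun x : 'cV_k => (H *m x) i ord0)
    [set y | y <= h i ord0]); last exact: closed_le.
  by move=> x _; exact: mulmx_coord_continuous.
by apply/seteqP; split=> [x Hx i _|x Hx i]; [exact: Hx|exact: (Hx i I)].
Qed.

Lemma closed_polytope (R : realType) (k : nat) (T : set 'cV[R]_k) :
  polytope T -> closed T.
Proof. by move=> [_ [r [H [h ->]]]]; exact: closed_polyhedron. Qed.

Lemma ler_coord_norm (R : realType) (k l : nat) (A : 'M[R]_(k, l)) i j :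
  `|A i j| <= `|A|.
Proof.
rewrite [leRHS]/Num.norm /= mx_normrE.
exact: (le_bigmax _ (fun ij : 'I_k * 'I_l => `|A ij.1 ij.2|) (i, j)).
Qed.

Lemma norm_trmx (R : realType) (k l : nat) (A : 'M[R]_(k, l)) :
  `|A^T| <= `|A|.
Proof.
rewrite [leLHS]/Num.norm /= mx_normrE; apply: bigmax_le => // -[i j] _ /=.
by rewrite mxE ler_coord_norm.
Qed.

(** The Heine-Borel theorem for row vectors, transported by transposition. *)
Lemma compact_polytope (R : realType) (k : nat) (T : set 'cV[R]_k) :
  polytope T -> compact T.
Proof.
move=> Tpoly; have [[M [Mr TM]] _] := Tpoly.
rewrite (_ : T = (fun v : 'rV_k => v^T) @` [set v | T v^T]).
  apply: continuous_compact.
    by apply: continuous_subspaceT; exact: trmx_continuous.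
  apply: bounded_closed_compact.
    exists M; split=> // y My v /= /(TM _ My); apply: le_trans.
    by rewrite -{1}(trmxK v); exact: norm_trmx.
  apply: (@preimage_closed _ _ (fun v : 'rV_k => v^T) T).
    by move=> x _; exact: trmx_continuous.
  exact: closed_polytope.
apply/seteqP; split=> [x Tx|_ [v Tv <-]//].
by exists x^T; rewrite /= trmxK.
Qed.

Lemma convex_polytope (R : realType) (k : nat) (T : set 'cV[R]_k)
    (l : R) x y : polytope T -> 0 < l < 1 -> T x -> T y ->
  T (l *: x + (1 - l) *: y).
Proof.
move=> [_ [r [H [h ->]]]] /andP[l0 l1] Tx Ty i.
have := Tx i; have := Ty i.
by rewrite mulmxDr -!scalemxAr !mxE; nra.
Qed.

Lemma compact_ubound (R : realType) (k : nat) (T : set 'cV[R]_k)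
    (f : 'cV[R]_k -> R) :
  compact T -> continuous f -> exists K : R, forall x, T x -> f x <= K.
Proof.
move=> cT cf; have : compact (f @` T).
  by apply: continuous_compact => //; exact: continuous_subspaceT.
move=> /compact_bounded[M [Mr fM]]; exists (M + 1) => x Tx.
have : `|f x| <= M + 1 by apply: fM; [rewrite ltrDl|exists x].
exact: le_trans (ler_norm _).
Qed.

(** A quadratic form differs from its chord by an exact multiple of its value at
    the difference; for a positive definite form this is strong convexity. *)
Lemma qform_convex_comb (R : realType) (k : nat) (M : 'M[R]_k) (l : R)
    (x y : 'cV[R]_k) :
  qform M (l *: x + (1 - l) *: y) =
  l * qform M x + (1 - l) * qform M y - l * (1 - l) * qform M (x - y).
Proof.
pose b (u v : 'cV[R]_k) : R := (u^T *m M *m v) ord0 ord0.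
have bDl u v w : b (u + v) w = b u w + b v w.
  by rewrite /b linearD !mulmxDl mxE.
have bDr u v w : b w (u + v) = b w u + b w v by rewrite /b mulmxDr mxE.
have bZl a u v : b (a *: u) v = a * b u v.
  by rewrite /b linearZ -!scalemxAl mxE.
have bZr a u v : b u (a *: v) = a * b u v by rewrite /b -scalemxAr mxE.
rewrite -[qform _ _]/(b _ _) -[qform _ x]/(b _ _) -[qform _ y]/(b _ _).
rewrite -[qform _ _]/(b _ _) -(scaleN1r y) !(bDl, bDr, bZl, bZr); ring.
Qed.

(** * Nonnegative closed convex costs and their expectation *)

(** Convexity for functions with values in the extended reals; the endpoints
    are left out so that the weights are positive and +oo propagates. *)
Definition econvex (R : realType) (V : lmodType R) (f : V -> \bar R) : Prop :=
  forall l x y, 0 < l < 1 ->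
    (f (l *: x + (1 - l) *: y)%R <= l%:E * f x + (1 - l)%:E * f y)%E.

(** The invariant of the recursion. Nonnegativity makes every integral and every
    sum below meaningful without integrability; lower semicontinuity makes the
    integrands measurable. *)
Definition closed_convex (R : realType) (k : nat) (V : 'cV[R]_k -> \bar R) :
    Prop :=
  [/\ forall x, (0 <= V x)%E, econvex V & lower_semicontinuous V].

Lemma lsc_comp (R : realType) (X Y : topologicalType) (V : Y -> \bar R)
    (f : X -> Y) :
  continuous f -> lower_semicontinuous V -> lower_semicontinuous (V \o f).
Proof.
move=> cf lV x a /lV[A nA VA]; exists (f @^-1` A); first exact: cf.
by move=> y /VA.
Qed.

(** Sequential form of lower semicontinuity, as needed for the lemma of Fatou. *)
Lemma lsc_limn_einf (R : realType) (X : topologicalType) (V : X -> \bar R)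
    (u : nat -> X) (x : X) :
  lower_semicontinuous V -> u k @[k --> \oo] --> x ->
  (V x <= limn_einf (V \o u))%E.
Proof.
move=> lV ux; rewrite limn_einf_lim.
have ein : cvg (einfs (V \o u) k @[k --> \oo]) by exact: is_cvg_einfs.
suff H a : (a%:E < V x)%E -> (a%:E <= limn (einfs (V \o u)))%E.
  move: H; case: (V x) => [r||]; last by rewrite leNye.
    move=> H; apply/lee_addgt0Pr => e e0.
    rewrite -leeBlDr// -EFinB; apply: H.
    by rewrite lte_fin ltrBlDr ltrDl.
  move=> H; rewrite leye_eq; apply/eqP/eqyP => A A0.
  by apply: H; rewrite ltry.
move=> /lV[A nA VA]; apply: lime_ge => //.
have [N _ NA] := ux _ nA; exists N => // k /= Nk.
apply: le_ereal_inf_tmp => _ [j /= kj <-].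
by apply/ltW/VA/NA => /=; exact: leq_trans Nk kj.
Qed.

Section Expectation.
Context (R : realType) (dO : measure_display) (Omega : measurableType dO).
Context (P : probability Omega R) (n : nat) (d : Omega -> 'cV[R]_n).
Context (md : measurable_fun setT (d : Omega -> borelV R n)).
Context (V : 'cV[R]_n -> \bar R).
Implicit Types (x y : 'cV[R]_n).

(** Strict superlevel sets of a lower semicontinuous function are open,
    hence Borel, and d is Borel measurable. *)
Lemma measurable_lsc_translate y : lower_semicontinuous V ->
  measurable_fun setT (fun w => V (y + d w)).
Proof.
move=> lV; apply: (measurability _ (ErealGenOInfty.measurableE R)).
move=> /= _ [_ [a ->]] <-.
rewrite preimage_itvoy.
have := md measurableT (_ : measurable ([set z | (a%:E < V (y + z))%E] :
  set (borelV R n))).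
apply; apply: sub_sigma_algebra.
apply: (@open_comp _ _ (fun z => y + z) [set z | (a%:E < V z)%E]).
  move=> z _; apply: (@continuousD _ _ _ (fun=> y) (fun x : 'cV[R]_n => x)).
    exact: cst_continuous.
  exact: cvg_id.
by move/lower_semicontinuousP : lV; exact.
Qed.

Definition mean_cost y : \bar R := (\int[P]_w V (y + d w)%R)%E.

(** The pointwise convexity inequality is integrated; linearity of the integral
    is where measurability of the integrand enters. *)
Lemma econvex_mean_cost : closed_convex V -> econvex mean_cost.
Proof.
move=> [V0 cV lV] l x y /[dup] l01 /andP[l0 l1].
have mV z : measurable_fun setT (fun w => V (z + d w)).
  exact: measurable_lsc_translate.
have l'0 : 0 <= 1 - l by rewrite subr_ge0 ltW.
rewrite /mean_cost -!ge0_integralZl_EFin//; last exact: ltW.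
rewrite -ge0_integralD//; first last.
- exact: measurable_funeM.
- by move=> w _; rewrite mule_ge0 ?lee_fin.
- exact: measurable_funeM.
- by move=> w _; rewrite mule_ge0 ?lee_fin// ltW.
apply: ge0_le_integral => //.
  by apply: emeasurable_funD; exact: measurable_funeM.
move=> w _; have := cV l (x + d w) (y + d w) l01.
congr (V _ <= _)%E.
by rewrite !scalerDr addrACA -scalerDl subrKC scale1r.
Qed.

(** Otherwise some sequence u_k tending to y has expected costs at most a, and
    Fatou bounds the expected cost at y by a as well. *)
Lemma lsc_mean_cost : closed_convex V -> lower_semicontinuous mean_cost.
Proof.
move=> [V0 cV lV] y a aVy; apply: contrapT => nVa.
have H k : exists z, ball y (k.+1%:R^-1) z /\ (mean_cost z <= a%:E)%E.
  apply: contrapT => nz; apply: nVa; exists (ball y k.+1%:R^-1).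
    exact: nbhsx_ballx.
  move=> z yz; rewrite ltNge; apply/negP => Vz.
  by apply: nz; exists z.
have /choice[u uP] := H.
have uy : u k @[k --> \oo] --> y.
  apply/cvg_ballP => e e0; near=> k.
  have [yu _] := uP k; apply: le_ball yu.
  by apply: ltW; near: k; exact: near_infty_natSinv_lt (PosNum e0).
have mu k : measurable_fun setT (fun w => V (u k + d w)).
  exact: measurable_lsc_translate.
have := fatou P measurableT mu (fun k w _ => V0 (u k + d w)).
apply/negP; rewrite -ltNge; apply: (@le_lt_trans _ _ a%:E).
  rewrite limn_einf_lim; apply: lime_le; first exact: is_cvg_einfs.
  apply: nearW => k; apply: ge_ereal_inf; exists (mean_cost (u k)).
    by exists k => //=.
  by have [] := uP k.
apply: (lt_le_trans aVy); apply: ge0_le_integral => //.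
- exact: measurable_lsc_translate.
- rewrite /limn_einf; apply: measurableT_comp => //.
  by apply: measurable_fun_limn_esup => k; exact: measurableT_comp.
- move=> w _; apply: (@lsc_limn_einf _ _ V (fun k => u k + d w)) => //.
  by apply: cvgD => //; exact: cvg_cst.
Unshelve. all: by end_near. Qed.

Lemma closed_convex_mean_cost : closed_convex V -> closed_convex mean_cost.
Proof.
move=> cV; split; [|exact: econvex_mean_cost|exact: lsc_mean_cost].
by move=> y; apply: integral_ge0 => w _; case: cV.
Qed.

End Expectation.

(** * Partial minimization *)

Lemma lsc_addr (R : realType) (X : topologicalType) (s : X -> R)
    (V : X -> \bar R) :
  continuous s -> lower_semicontinuous V ->
  lower_semicontinuous (fun x => (s x)%:E + V x)%E.
Proof.
move=> cs lV x a aV.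
have [b ab bV] : exists2 b, a - s x < b & (b%:E < V x)%E.
  move: aV; case: (V x) => [r||//].
    rewrite -EFinD lte_fin => aV; exists ((a - s x + r) / 2); last rewrite lte_fin.
      by lra.
    by lra.
  by move=> _; exists (a - s x + 1); [lra|rewrite ltry].
have [A nA VA] := lV _ _ bV.
exists (A `&` [set y | a - b < s y]).
  apply: filterI => //; apply: (cs x [set z | a - b < z]).
  by apply: lt_nbhsr; rewrite ltrBlDr -ltrBlDl.
move=> y [/VA by_ /= sy].
have -> : a = (a - b) + b by lra.
by rewrite EFinD; apply: lteD => //; rewrite lte_fin.
Qed.

(** Around a point x, every input u of the compact K is either infeasible, and
    stays so nearby because the graph of C is closed, or has cost above a
    given level, and keeps it nearby. Compactness of K makes the neighbourhood
    of x uniform in u. *)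
Lemma lsc_partial_inf (R : realType) (X Y : topologicalType) (K : set Y)
    (C : X -> set Y) (f : X -> Y -> \bar R) :
  compact K -> (forall x, C x `<=` K) ->
  closed [set ux : Y * X | C ux.2 ux.1] ->
  lower_semicontinuous (fun ux : Y * X => f ux.2 ux.1) ->
  lower_semicontinuous (fun x => ereal_inf [set f x u | u in C x]).
Proof.
move=> /compact_near_coveringP cK CK cC lf x a ax.
(* A real number strictly between a and the infimum: nearby infima are only
   shown to be at least b. *)
have [b ab bx] : exists2 b, a < b &
    (b%:E < ereal_inf [set f x u | u in C x])%E.
  move: ax; case: (ereal_inf _) => [r||//].
    by rewrite lte_fin => ar; exists ((a + r) / 2); rewrite ?lte_fin; lra.
  by move=> _; exists (a + 1); rewrite ?ltry//; lra.
exists [set y | forall u, K u -> C y u -> (b%:E < f y u)%E]; last first.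
  move=> y Hy; apply: (@lt_le_trans _ _ b%:E); first by rewrite lte_fin.
  by apply: le_ereal_inf_tmp => _ [u Cu <-]; apply/ltW/Hy => //; exact: CK Cu.
apply: (cK X (nbhs x) (fun y u => C y u -> (b%:E < f y u)%E)) => u Ku.
have [Cu|nCu] := pselect (C x u).
  have bu : (b%:E < f x u)%E.
    by apply: (lt_le_trans bx); apply: ge_ereal_inf; exists (f x u) => //; exists u.
  have [A nA fA] := lf (u, x) b bu.
  by apply: (filterS _ nA) => -[v y] /fA.
have : nbhs (u, x) (~` [set ux : Y * X | C ux.2 ux.1]).
  by apply: open_nbhs_nbhs; split=> //; exact: closed_openC.
by apply: filterS => -[v y] /= nC /nC.
Qed.

(** Almost optimal inputs at x and y combine into an input that is feasible at
    the convex combination and almost realizes the combined costs. *)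
Lemma econvex_partial_inf (R : realType) (X Y : lmodType R) (C : X -> set Y)
    (f : X -> Y -> \bar R) :
  (forall x u, 0 <= f x u)%E ->
  (forall l x y u v, 0 < l < 1 -> C x u -> C y v ->
    C (l *: x + (1 - l) *: y) (l *: u + (1 - l) *: v)) ->
  (forall l x y u v, 0 < l < 1 ->
    (f (l *: x + (1 - l) *: y)%R (l *: u + (1 - l) *: v)%R <=
     l%:E * f x u + (1 - l)%:E * f y v)%E) ->
  econvex (fun x => ereal_inf [set f x u | u in C x]).
Proof.
move=> f0 cC cf l x y /[dup] l01 /andP[l0 l1].
pose g z := ereal_inf [set f z u | u in C z]; rewrite -/(g _) -/(g x) -/(g y).
have g0 z : (0 <= g z)%E by apply: le_ereal_inf_tmp => _ [u _ <-].
have l'0 : 0 < 1 - l by rewrite subr_gt0.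
have [gx|[a a0 gx]] := (gee0P (g x)).1 (g0 x).
  rewrite gx gt0_muley ?lte_fin// addye ?leey// gt_eqF//.
  by apply: (lt_le_trans ltNy0); rewrite mule_ge0// lee_fin ltW.
have [gy|[b b0 gy]] := (gee0P (g y)).1 (g0 y).
  by rewrite gx gy (@gt0_muley _ (1 - l)%:E) ?lte_fin// -EFinM addey ?leey.
rewrite gx gy; apply/lee_addgt0Pr => e e0.
have [_ [u Cu <-] fu] : exists2 z, [set f x u | u in C x] z & (z < (a + e)%:E)%E.
  have := @lb_ereal_inf_adherent R [set f x u | u in C x] e e0.
  by rewrite -/(g x) gx EFinD; apply.
have [_ [v Cv <-] fv] : exists2 z, [set f y u | u in C y] z & (z < (b + e)%:E)%E.
  have := @lb_ereal_inf_adherent R [set f y u | u in C y] e e0.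
  by rewrite -/(g y) gy EFinD; apply.
apply: (@le_trans _ _ (f (l *: x + (1 - l) *: y) (l *: u + (1 - l) *: v))).
  by apply: ge_ereal_inf; eexists; [exists (l *: u + (1 - l) *: v); [exact: cC|]|].
apply: le_trans (cf _ _ _ _ _ l01) _.
apply: (@le_trans _ _ (l%:E * (a + e)%:E + (1 - l)%:E * (b + e)%:E)%E).
  by apply: leeD; apply: lee_wpmul2l; rewrite ?lee_fin ?ltW.
by rewrite -!EFinM -!EFinD lee_fin; lra.
Qed.

Lemma posdefmx_ge0 (R : realType) (k : nat) (M : 'M[R]_k) x :
  posdefmx M -> 0 <= qform M x.
Proof.
move=> [_ Mpos]; have [->|/Mpos/ltW//] := eqVneq x 0.
by rewrite /qform mulmx0 mxE.
Qed.

(** * Convexity of the dynamic program *)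

Section System.
Context (R : realType) (dO : measure_display) (Omega : measurableType dO).
Context (n m : nat) (S : ocp R Omega n m) (hS : standing_assumptions S).
Implicit Types (t k : nat) (x y : 'cV[R]_n) (u v : 'cV[R]_m).

Lemma nominal_convex_comb l x y u v :
  nominal S (l *: x + (1 - l) *: y) (l *: u + (1 - l) *: v) =
  l *: nominal S x u + (1 - l) *: nominal S y v.
Proof. by rewrite /nominal !mulmxDr -!scalemxAr !scalerDr addrACA. Qed.

Lemma nominal_continuous :
  continuous (fun ux : 'cV[R]_m * 'cV[R]_n => nominal S ux.2 ux.1).
Proof.
move=> [u x]; apply: (@continuousD _ _ _
  (fun ux : 'cV[R]_m * 'cV[R]_n => dynA S *m ux.2)
  (fun ux : 'cV[R]_m * 'cV[R]_n => dynB S *m ux.1)).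
  by apply: continuous_comp; [exact: cvg_snd|exact: mulmx_continuous].
by apply: continuous_comp; [exact: cvg_fst|exact: mulmx_continuous].
Qed.

Lemma stage_cost_continuous t :
  continuous (fun ux : 'cV[R]_m * 'cV[R]_n => stage_cost S t ux.2 ux.1).
Proof.
move=> [u x]; apply: (@continuousD _ _ _
  (fun ux : 'cV[R]_m * 'cV[R]_n => qform (stateW S t) ux.2)
  (fun ux : 'cV[R]_m * 'cV[R]_n => qform (inputW S t) ux.1)).
  by apply: continuous_comp; [exact: cvg_snd|exact: qform_continuous].
by apply: continuous_comp; [exact: cvg_fst|exact: qform_continuous].
Qed.

Lemma stage_cost_ge0 t x u : (t < horizon S)%N -> 0 <= stage_cost S t x u.
Proof.
move=> tN; apply: addr_ge0; apply: posdefmx_ge0.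
  by apply: (stateW_posdef hS); exact: ltnW.
exact: (inputW_posdef hS).
Qed.

Lemma closed_robust_inputs t (T : set 'cV[R]_n) : closed T ->
  closed [set ux : 'cV[R]_m * 'cV[R]_n | robust_inputs S t T ux.2 ux.1].
Proof.
move=> cT; rewrite (_ : mkset _ =
    (fst @^-1` inputC S) `&` \bigcap_(d in distC S t)
      ((fun ux : 'cV[R]_m * 'cV[R]_n => nominal S ux.2 ux.1 + d) @^-1` T)).
  apply: closedI.
    apply: preimage_closed; first by move=> [? ?] _; exact: cvg_fst.
    exact: closed_polytope (inputC_polytope hS).
  apply: closed_bigI => d _; apply: preimage_closed => // ux _.
  apply: (@continuousD _ _ _
    (fun ux : 'cV[R]_m * 'cV[R]_n => nominal S ux.2 ux.1) (fun=> d)).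
    exact: nominal_continuous.
  exact: cst_continuous.
by apply/seteqP; split=> -[u x] [Uu Tu]; split=> // d Dd; exact: Tu Dd.
Qed.

Lemma convex_robust_inputs t (T : set 'cV[R]_n) l x y u v : polytope T ->
  0 < l < 1 -> robust_inputs S t T x u -> robust_inputs S t T y v ->
  robust_inputs S t T (l *: x + (1 - l) *: y) (l *: u + (1 - l) *: v).
Proof.
move=> pT l01 [Uu Tu] [Uv Tv]; split.
  by apply: convex_polytope => //; exact: (inputC_polytope hS).
move=> d Dd.
have := convex_polytope pT l01 (Tu d Dd) (Tv d Dd).
by congr T; rewrite nominal_convex_comb !scalerDr addrACA -scalerDl subrKC scale1r.
Qed.

(** The cost of one stage for an arbitrary cost-to-go V; J is the case where V
    is the exact optimal cost. *)
Definition step_cost t (V : 'cV[R]_n -> \bar R) x u : \bar R :=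
  ((stage_cost S t x u)%:E
   + mean_cost (prob S) (dist S t) V (nominal S x u))%E.

Lemma step_cost_ge0 t V x u : (t < horizon S)%N -> closed_convex V ->
  (0 <= step_cost t V x u)%E.
Proof.
move=> tN cV; apply: adde_ge0; first by rewrite lee_fin stage_cost_ge0.
by have [] := closed_convex_mean_cost (prob S) (dist_measurable hS t) cV.
Qed.

Lemma lsc_step_cost t V : closed_convex V ->
  lower_semicontinuous (fun ux : 'cV[R]_m * 'cV[R]_n => step_cost t V ux.2 ux.1).
Proof.
move=> cV; apply: lsc_addr; first exact: stage_cost_continuous.
apply: (lsc_comp nominal_continuous).
by have [] := closed_convex_mean_cost (prob S) (dist_measurable hS t) cV.
Qed.

(** The expectation is only convex; the defect comes from the quadratic stage
    cost. The statement adds the defect on the left since subtraction in the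
    extended reals would be ambiguous at +oo. *)
Lemma step_cost_strongly_convex t V l x y u v :
  closed_convex V -> 0 < l < 1 ->
  (step_cost t V (l *: x + (1 - l) *: y)%R (l *: u + (1 - l) *: v)%R
   + (l * (1 - l) * stage_cost S t (x - y)%R (u - v)%R)%:E
   <= l%:E * step_cost t V x u + (1 - l)%:E * step_cost t V y v)%E.
Proof.
move=> cV /[dup] l01 /andP[l0 l1]; rewrite /step_cost nominal_convex_comb.
have [W0 cW _] := closed_convex_mean_cost (prob S) (dist_measurable hS t) cV.
move: (mean_cost _ _ _) W0 cW => W W0 cW.
have l'0 : 0 < 1 - l by rewrite subr_gt0.
have := cW l (nominal S x u) (nominal S y v) l01.
have := W0 (l *: nominal S x u + (1 - l) *: nominal S y v).
have [->|[a a0 ->]] := (gee0P (W (nominal S x u))).1 (W0 _);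
  have [->|[b b0 ->]] := (gee0P (W (nominal S y v))).1 (W0 _).
- by move=> _ _; rewrite !addey// !gt0_muley ?lte_fin// leey.
- by move=> _ _; rewrite addey// gt0_muley ?lte_fin// -EFinD -EFinM addye ?leey.
- by move=> _ _; rewrite addey// (@gt0_muley _ (1 - l)%:E) ?lte_fin// -EFinD
    -EFinM addey ?leey.
- rewrite -!EFinM -!EFinD; case: (W _) => [c| |] //.
  rewrite -!EFinD !lee_fin /stage_cost !qform_convex_comb => _; lra.
Qed.

(** The recursion does not restrict x to the state constraints, so the costs are
    convex and lower semicontinuous on the whole space. *)
Lemma closed_convex_cost_to_go k : (k <= horizon S)%N ->
  closed_convex (cost_to_go S (exact_ant S) k).
Proof.
elim: k => [_|k IHk kN].
  have pQ : posdefmx (stateW S (horizon S)) by exact: (stateW_posdef hS).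
  split=> [x|l x y /andP[l0 l1]|x a].
  - by rewrite lee_fin posdefmx_ge0.
  - rewrite /= -!EFinM -!EFinD lee_fin qform_convex_comb lerBlDr lerDl.
    rewrite mulr_ge0 ?posdefmx_ge0// mulr_ge0//; first exact: ltW.
    by rewrite subr_ge0 ltW.
  - rewrite /= lte_fin => ax.
    exists [set y | a < qform (stateW S (horizon S)) y].
      apply: (@qform_continuous R n (stateW S (horizon S)) x [set z | a < z]).
      exact: lt_nbhsr.
    by move=> y; rewrite /= lte_fin.
have {}IHk := IHk (ltnW kN).
have tN : (horizon S - k.+1 < horizon S)%N by rewrite ltn_subrL (leq_trans _ kN).
have pX : polytope (stateC S (horizon S - k.+1).+1).
  exact: (stateC_polytope hS).
split.
- move=> x; apply: le_ereal_inf_tmp => _ [u _ <-].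
  exact: step_cost_ge0 tN IHk.
- apply: (econvex_partial_inf (f := step_cost (horizon S - k.+1) _)).
  + by move=> x u; exact: step_cost_ge0 tN IHk.
  + by move=> l x y u v; exact: convex_robust_inputs.
  + move=> l x y u v l01; apply: le_trans (step_cost_strongly_convex _ _ _ _ _ IHk l01).
    rewrite leeDl// lee_fin mulr_ge0 ?stage_cost_ge0//.
    by case/andP: l01 => l0 l1; rewrite mulr_ge0// ?subr_ge0; exact: ltW.
- apply: (lsc_partial_inf (K := inputC S)
    (f := step_cost (horizon S - k.+1) _)).
  + exact: compact_polytope (inputC_polytope hS).
  + by move=> x u [].
  + by apply: closed_robust_inputs; exact: closed_polytope.
  + exact: lsc_step_cost.
Qed.

End System.

(** * Comparison of the restricted and the exact problem *)

Section RestrictedProblem.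
Context (R : realType) (dO : measure_display) (Omega : measurableType dO).
Context (n m : nat) (S : ocp R Omega n m) (hS : standing_assumptions S).
Implicit Types (t : nat) (x : 'cV[R]_n) (u v : 'cV[R]_m).

(** The supremum is meaningful because the disturbance set is compact. *)
Lemma le_max_dist t (r : nat) (H : 'M[R]_(r, n)) i d :
  distC S t d -> (H *m d) i ord0 <= max_dist S t H i.
Proof.
move=> Dd; apply: ub_le_sup; last by exists d.
have [|K HK] := compact_ubound (f := fun x : 'cV[R]_n => (H *m x) i ord0)
    (compact_polytope (distC_polytope hS t)).
  exact: mulmx_coord_continuous.
by exists K => _ [z Dz <-]; exact: HK.
Qed.

(** Shared rows hold along the whole segment from u to v by convexity of the
    larger polytope. Exclusive rows are strict at u uniformly in the disturbance,
    because their slack is measured against the worst one, and there are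
    finitely many of them, so one small step serves all rows and disturbances. *)
Lemma robust_inputs_short_step t (p q : nat) (Rx : 'M[R]_(p, n))
    (Rc : 'cV[R]_p) (Px : 'M[R]_(q, n)) (Pc : 'cV[R]_q) x u v :
  polytope (polyhedron Px Pc) ->
  polyhedron Rx Rc `<=` polyhedron Px Pc ->
  robust_inputs S t (polyhedron Rx Rc) x u ->
  (forall i, exclusive_rows Rx Rc Px Pc i ->
    robust_lhs S t Rx x u i < Rc i ord0) ->
  robust_inputs S t (polyhedron Px Pc) x v ->
  exists l, 0 < l < 1 /\
    robust_inputs S t (polyhedron Rx Rc) x (l *: v + (1 - l) *: u).
Proof.
move=> pX RX uR inact vX.
pose a i := (Rx *m nominal S x v) i ord0.
pose b i := (Rx *m nominal S x u) i ord0.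
have small : \forall l \near 0^'+, forall i, exclusive_rows Rx Rc Px Pc i ->
    l * (a i - b i) < Rc i ord0 - robust_lhs S t Rx x u i.
  apply: filter_forall => i.
  have [/inact Ei|nEi] := pselect (exclusive_rows Rx Rc Px Pc i); last first.
    by apply: nearW => l /nEi.
  have lim0 : l * (a i - b i) @[l --> (0 : R)^'+] --> 0 * (a i - b i).
    by apply: cvgMl; apply: cvg_at_right_filter; exact: cvg_id.
  near=> l => _; near: l; apply: (cvgr_lt _ lim0).
  by rewrite mul0r subr_gt0.
near (0 : R)^'+ => l.
have l0 : 0 < l by [].
have l1 : l < 1 by near: l; exact: nbhs_right_lt.
have l01 : 0 < l < 1 by rewrite l0 l1.
have mixE : nominal S x (l *: v + (1 - l) *: u) =
    l *: nominal S x v + (1 - l) *: nominal S x u.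
  rewrite -nominal_convex_comb; congr (nominal _ _ _).
  by rewrite -scalerDl subrKC scale1r.
have uX : robust_inputs S t (polyhedron Px Pc) x u.
  by split; [case: uR|move=> d Dd; apply: RX; case: uR => _; exact].
have [Umix Xmix] := convex_robust_inputs hS pX l01 vX uX.
exists l; split=> //; split=> // d Dd i.
have [Ei|nEi] := pselect (exclusive_rows Rx Rc Px Pc i).
  have : l * (a i - b i) < Rc i ord0 - robust_lhs S t Rx x u i.
    by move: i Ei; near: l.
  have := le_max_dist Rx i Dd.
  rewrite mixE !mulmxDr -!scalemxAr !mxE /robust_lhs /a /b !mxE.
  move: (\sum_j _) (\sum_j _) (\sum_j _) => A B D; nra.
have [j [rowE rhsE]] : exists j, row i Rx = row j Px /\ Rc i ord0 = Pc j ord0.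
  exact: contrapT nEi.
have := Xmix d Dd j; rewrite -scalerDl subrKC scale1r -rhsE.
congr (_ <= _).
have := congr1 (fun A => (A *m (nominal S x (l *: v + (1 - l) *: u) + d))
  ord0 ord0) rowE.
by rewrite -!row_mul !mxE.
Unshelve. all: by end_near. Qed.

Lemma closed_convex_Jstar t : closed_convex (Jstar S t).
Proof. by apply: (closed_convex_cost_to_go hS); exact: leq_subr. Qed.

Lemma J_step_cost t x u : J S t x u = step_cost S t (Jstar S t.+1) x u.
Proof. by []. Qed.

(** All successors of (x, u) lie in the compact T, on which the optimal cost is
    quadratic and hence bounded. Without this an optimizer could have cost +oo
    and would then carry no information about the larger problem. *)
Lemma J_ltey t (T : set 'cV[R]_n) x u : polytope T ->
  ce_optimal_on S t.+1 T -> robust_inputs S t T x u -> (J S t x u < +oo)%E.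
Proof.
move=> pT [_ _ _ [M [g [c Jq]]]] [_ uT].
have [|K HK] := compact_ubound
    (f := fun z => qform M z + (g^T *m z) ord0 ord0 + c) (compact_polytope pT).
  move=> z; apply: (@continuousD _ _ _
    (fun z => qform M z + (g^T *m z) ord0 ord0) (fun=> c)); last first.
    exact: cst_continuous.
  apply: (@continuousD _ _ _ (qform M) (fun z : 'cV_n => (g^T *m z) ord0 ord0)).
    exact: qform_continuous.
  exact: mulmx_coord_continuous.
rewrite J_step_cost.
apply: (@le_lt_trans _ _ ((stage_cost S t x u)%:E + K%:E)%E); last first.
  by rewrite -EFinD ltry.
apply: leeD => //.
have [V0 _ lV] := closed_convex_Jstar t.+1.
have -> : K%:E = (\int[prob S]_w (cst K%:E w))%E.
  by rewrite integral_cst//= probability_setT mule1.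
apply: ge0_le_integral => //.
  by apply: (measurable_lsc_translate (dist_measurable hS t)); exact: lV.
move=> w _; have Tw : T (nominal S x u + dist S t w).
  by apply: uT; exact: (dist_in hS).
by rewrite Jq// lee_fin HK.
Qed.

(** A local minimizer of a strictly convex function is its strict global
    minimizer, with locality replaced by the short feasible step towards v. *)
Lemma restricted_optimizer_lt t (p q : nat) (Rx : 'M[R]_(p, n))
    (Rc : 'cV[R]_p) (Px : 'M[R]_(q, n)) (Pc : 'cV[R]_q) x u v :
  (t < horizon S)%N ->
  polytope (polyhedron Rx Rc) -> polytope (polyhedron Px Pc) ->
  polyhedron Rx Rc `<=` polyhedron Px Pc ->
  ce_optimal_on S t.+1 (polyhedron Rx Rc) ->
  restricted_optimizers S t (polyhedron Rx Rc) x u ->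
  (forall i, exclusive_rows Rx Rc Px Pc i ->
    robust_lhs S t Rx x u i < Rc i ord0) ->
  robust_inputs S t (polyhedron Px Pc) x v -> v != u ->
  (J S t x u < J S t x v)%E.
Proof.
move=> tN pR pX RX ceR [uR uopt] inact vX vu.
have [l [/[dup] l01 /andP[l0 l1] mixR]] :=
  robust_inputs_short_step pX RX uR inact vX.
have Ju := J_ltey pR ceR uR.
have Jmix := J_ltey pR ceR mixR.
have := uopt _ mixR.
have := step_cost_strongly_convex hS t x x v u (closed_convex_Jstar t.+1) l01.
rewrite -scalerDl subrKC scale1r subrr.
have s0 : 0 < stage_cost S t 0 (v - u).
  rewrite /stage_cost {1}/qform mulmx0 mxE add0r.
  by have [_] := inputW_posdef hS tN; apply; rewrite subr_eq0.
have J0 w : (0 <= J S t x w)%E.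
  by rewrite J_step_cost; apply: (step_cost_ge0 hS) => //; exact: closed_convex_Jstar.
rewrite -!J_step_cost.
have [Jv|[b b0 ->]] := (gee0P (J S t x v)).1 (J0 v); first by rewrite Jv.
move: (J0 u) Ju => /gee0P[->//|[a a0 ->]] _.
move: (J0 (l *: v + (1 - l) *: u)) Jmix => /gee0P[->//|[c c0 ->]] _.
rewrite -!EFinM -!EFinD !lee_fin lte_fin => cab ac.
have : 0 < l * (1 - l) * stage_cost S t 0 (v - u).
  by rewrite !mulr_gt0// subr_gt0.
have : l * (b - a) <= 0 \/ a < b.
  by have [ab|ba] := ltP a b; [right|left; rewrite pmulr_rle0 ?subr_le0].
by case=> //; lra.
Qed.

End RestrictedProblem.

Unset Implicit Arguments.

Theorem proposition2 (R : realType) (dO : measure_display)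
    (Omega : measurableType dO) (n m : nat) (S : ocp R Omega n m)
    (hS : standing_assumptions S)
    (t : nat) (ht : (t.+2 <= horizon S)%N)
    (Rset : set 'cV[R]_n) (hRpoly : polytope Rset)
    (hRX : Rset `<=` stateC S t.+1)
    (hopt : ce_optimal_on S t.+1 Rset)
    (p q : nat) (Rx : 'M[R]_(p, n)) (Rc : 'cV[R]_p)
    (Px : 'M[R]_(q, n)) (Pc : 'cV[R]_q)
    (hR : Rset = polyhedron Rx Rc)
    (hRnorm : normalized Rx) (hRmin : minimal_repr Rx Rc)
    (hX : stateC S t.+1 = polyhedron Px Pc)
    (hXnorm : normalized Px) (hXmin : minimal_repr Px Pc)
    (s : nat) (Ux : 'M[R]_(s, m)) (Uc : 'cV[R]_s)
    (hU : inputC S = polyhedron Ux Uc)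
    (C : set 'cV[R]_n)
    (hC : exists (I : set 'I_p) (K : set 'I_s),
        C = critical_region S t Rx Rc Ux Uc I K)
    (hinactive : forall x, C x ->
        forall u, restricted_optimizers S t Rset x u ->
        forall i, exclusive_rows Rx Rc Px Pc i ->
          robust_lhs S t Rx x u i < Rc i ord0) :
  forall x, C x ->
    restricted_optimizers S t Rset x =
    restricted_optimizers S t (stateC S t.+1) x.
Proof.
move=> x Cx.
have pX : polytope (polyhedron Px Pc).
  by rewrite -hX; apply: (stateC_polytope hS); exact: ltnW.
(* A critical region contains only parameters at which an optimizer exists. *)
have [ustar ustarR] : exists u, restricted_optimizers S t Rset x u.
  case: hC => I [K CE]; move: Cx; rewrite CE => -[_ [u uR _]].
  by exists u; rewrite hR.
have RX : forall u, robust_inputs S t Rset x u ->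
    robust_inputs S t (stateC S t.+1) x u.
  by move=> u [Uu Ru]; split=> // d Dd; apply/hRX/Ru.
have lt_opt u v : restricted_optimizers S t Rset x u ->
    robust_inputs S t (stateC S t.+1) x v -> v != u ->
    (J S t x u < J S t x v)%E.
  move=> uR; rewrite hX; rewrite hX hR in hRX; rewrite hR in hRpoly hopt.
  apply: (restricted_optimizer_lt hS (ltnW ht) hRpoly pX hRX hopt).
    by rewrite -hR.
  exact: hinactive uR.
apply/seteqP; split=> [u uR|v [vX vopt]].
  split; first by case: uR => /RX.
  by move=> v vX; have [->//|/(lt_opt _ _ uR vX)/ltW] := eqVneq v u.
have [->//|/(lt_opt _ _ ustarR vX)] := eqVneq v ustar.
by rewrite ltNge vopt//; case: ustarR => /RX.
Qed.
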